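(* Let $n\ge 1$, $L>0$, $p\ge 3$, $\alpha_k=\frac{p}{k+p}$ for $k\in\mathbb N=\{0,1,2,\dots\}$, and $\eta\in(0,\frac{2}{3L}]$. Let $(\mathbf{x}_k),(\mathbf{y}_k),(\mathbf{z}_k)$ be generated by the Nesterov--Spokoiny Acceleration (NSA) algorithm (described in the context) for an objective $f:\mathbb R^n\to\mathbb R$ with step size $\eta$. (A) Suppose $f$ is convex, continuously differentiable, with $L$-Lipschitz gradient, and attains its minimum $f^*=\min_{\mathbf{x}\in\mathbb R^n} f(\mathbf{x})>-\infty$. Then: 1. $\displaystyle\limsup_{k\to\infty}k^2\,(f(\mathbf{x}_k)-f^* )=0$ and $\displaystyle\liminf_{k\to\infty}k^2\log k\,\log\log k\,(f(\mathbf{x}_k)-f^* )=0$; 2. $\displaystyle\liminf_{k\to\infty}k^3\log k\,\log\log k\,\|\nabla f(\mathbf{y}_k)\|^2=0$. (B) Suppose instead only that $f$ is $L$-smooth (possibly nonconvex) and $f^*:=\inf_{\mathbf{x}\in\mathbb R^n}f(\mathbf{x})>-\infty$. Then for every $N\in\mathbb N$, $$\min_{k\in\{0,1,\dots,N\}}\|\nabla f(\mathbf{x}_k)\|^2\le\frac{3\,(f(\mathbf{x}_0)-f^* )}{2\eta(N+1)}.$$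
   Context: A function $f:\mathbb R^n\to\mathbb R$ is $L$-smooth if it is continuously differentiable and $\|\nabla f(\mathbf{x})-\nabla f(\mathbf{x}')\|\le L\|\mathbf{x}-\mathbf{x}'\|$ for all $\mathbf{x},\mathbf{x}'\in\mathbb R^n$ (Euclidean norm). NSA algorithm with step size $\eta>0$ and $\alpha_k=\frac{p}{k+p}$: pick $\mathbf{x}_0=\mathbf{z}_0\in\mathbb R^n$ (such that $\nabla f(\mathbf{x}_0)\ne 0$). For $k=0,1,2,\dots$ set $$\mathbf{y}_k=(1-\alpha_k)\mathbf{x}_k+\alpha_k\mathbf{z}_k,\qquad \mathbf{x}_{k+1}'=\mathbf{y}_k-\eta\nabla f(\mathbf{y}_k),\qquad \mathbf{x}_{k+1}''=\mathbf{x}_k-\eta\nabla f(\mathbf{x}_k),$$ $$\mathbf{x}_{k+1}=\begin{cases}\mathbf{x}_{k+1}'&\text{if } f(\mathbf{x}_{k+1}')\le f(\mathbf{x}_{k+1}''),\\ \mathbf{x}_{k+1}''&\text{otherwise,}\end{cases}\qquad \mathbf{z}_{k+1}=\mathbf{z}_k-\frac{\eta}{\alpha_k}\nabla f(\mathbf{y}_k).$$ *)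

(* Defs.v *)
From HB Require Import structures.
From mathcomp Require Import all_boot all_order all_algebra.
From mathcomp Require Import all_classical all_reals all_analysis.

Set Implicit Arguments.
Unset Strict Implicit.
Unset Printing Implicit Defensive.

Import Order.TTheory GRing.Theory Num.Theory.
Import numFieldNormedType.Exports.

Local Open Scope classical_set_scope.
Local Open Scope ring_scope.

(* The library's canonical norm `|v| on 'rV[R]_n is the sup norm; it induces
   the same topology and differentiability as the Euclidean one, but Lipschitz
   constants and norms of gradients need the latter. *)
Definition enorm (R : realType) (n : nat) (v : 'rV[R]_n) : R :=
  Num.sqrt (\sum_(i < n) v 0 i ^+ 2).

(* Like 'D_v f x, this is only meaningful where f is differentiable. *)
Definition grad (R : realType) (n : nat) (f : 'rV[R]_n -> R) (x : 'rV[R]_n) :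
  'rV[R]_n := \row_(i < n) 'D_(delta_mx 0 i) f x.

Record L_smooth (R : realType) (n : nat) (L : R) (f : 'rV[R]_n -> R) : Prop := {
  L_smooth_differentiable : forall x, differentiable f x;
  L_smooth_grad_continuous : continuous (grad f);
  L_smooth_grad_lipschitz :
    forall x x', enorm (grad f x - grad f x') <= L * enorm (x - x') }.

Definition is_minimum (R : realType) (n : nat) (f : 'rV[R]_n -> R) (m : R) : Prop :=
  range f m /\ lbound (range f) m.

Definition NSA_alpha (R : realType) (p : R) (k : nat) : R := p / (k%:R + p).

Record NSA_run (R : realType) (n : nat) (f : 'rV[R]_n -> R) (eta p : R)
    (x y z : nat -> 'rV[R]_n) : Prop := {
  NSA_init : x 0%N = z 0%N;
  NSA_init_grad : grad f (x 0%N) <> 0;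
  NSA_y : forall k,
    y k = (1 - NSA_alpha p k) *: x k + NSA_alpha p k *: z k;
  NSA_x : forall k,
    let x' := y k - eta *: grad f (y k) in
    let x'' := x k - eta *: grad f (x k) in
    x k.+1 = if f x' <= f x'' then x' else x'';
  NSA_z : forall k,
    z k.+1 = z k - (eta / NSA_alpha p k) *: grad f (y k) }.

(* Main.v *)
(* Since [L * eta <= 2/3], a gradient step from [v] lowers [f] by at least
   [(2/3) eta |grad f v|^2].  Both alternatives of the algorithm satisfy this
   bound from [x k], and telescoping it gives the nonconvex estimate.
   In the convex case the Lyapunov function
   [|z k - xs|^2 + 2 eta (k + p - 1)^2 / p^2 * (f (x k) - f xs)],
   with [xs] a minimizer,
   decreases by at least a multiple of
   [k (f (x k) - f xs) + k^2 |grad f (y k)|^2], so both series converge.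
   As [f (x k)] is nonincreasing, the dyadic blocks of the first series force
   [k^2 (f (x k) - f xs) --> 0]; the lower limits vanish because
   [ln (ln (ln k))] is unbounded while its increments are at most
   [1 / (k ln k ln (ln k))]. *)
Require Import Defs.
From HB Require Import structures.
From mathcomp Require Import all_boot all_order all_algebra.
From mathcomp Require Import all_classical all_reals all_analysis.
From mathcomp Require Import ring lra zify.

Import Order.TTheory GRing.Theory Num.Theory.
Import numFieldNormedType.Exports.

Set Implicit Arguments.
Unset Strict Implicit.
Unset Printing Implicit Defensive.

Local Open Scope classical_set_scope.
Local Open Scope ring_scope.

(** * Euclidean inner product *)

Definition dot (R : realType) (n : nat) (u v : 'rV[R]_n) : R :=
  \sum_(i < n) u 0 i * v 0 i.

Lemma enorm_sqr (R : realType) (n : nat) (v : 'rV[R]_n) :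
  enorm v ^+ 2 = dot v v.
Proof.
rewrite /enorm /dot sqr_sqrtr; last by apply: sumr_ge0 => i _; exact: sqr_ge0.
by apply: eq_bigr => i _; rewrite expr2.
Qed.

Lemma dot_ge0 (R : realType) (n : nat) (v : 'rV[R]_n) : 0 <= dot v v.
Proof. by rewrite -enorm_sqr sqr_ge0. Qed.

Lemma dotC (R : realType) (n : nat) (u v : 'rV[R]_n) : dot u v = dot v u.
Proof. by apply: eq_bigr => i _; rewrite mulrC. Qed.

Lemma dotDr (R : realType) (n : nat) (u v w : 'rV[R]_n) :
  dot u (v + w) = dot u v + dot u w.
Proof. by rewrite /dot -big_split; apply: eq_bigr => i _; rewrite mxE mulrDr. Qed.

Lemma dotZr (R : realType) (n : nat) (a : R) (u v : 'rV[R]_n) :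
  dot u (a *: v) = a * dot u v.
Proof. by rewrite /dot mulr_sumr; apply: eq_bigr => i _; rewrite mxE mulrCA. Qed.

Lemma dotDl (R : realType) (n : nat) (u v w : 'rV[R]_n) :
  dot (v + w) u = dot v u + dot w u.
Proof. by rewrite !(dotC _ u) dotDr. Qed.

Lemma dotZl (R : realType) (n : nat) (a : R) (u v : 'rV[R]_n) :
  dot (a *: v) u = a * dot v u.
Proof. by rewrite !(dotC _ u) dotZr. Qed.

Lemma dotNr (R : realType) (n : nat) (u v : 'rV[R]_n) : dot u (- v) = - dot u v.
Proof. by rewrite -scaleN1r dotZr mulN1r. Qed.

Lemma dotNl (R : realType) (n : nat) (u v : 'rV[R]_n) : dot (- u) v = - dot u v.
Proof. by rewrite -scaleN1r dotZl mulN1r. Qed.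

Definition dotE := (dotDr, dotDl, dotNr, dotNl, dotZr, dotZl).

(** * Gradients: chain rule, convexity and descent *)

Lemma diff_grad (R : realType) (n : nat) (f : 'rV[R]_n -> R) (x v : 'rV[R]_n) :
  differentiable f x -> 'd f x v = dot (grad f x) v.
Proof.
move=> df; rewrite [in LHS](row_sum_delta v) linear_sum.
by apply: eq_bigr => i _; rewrite linearZ /= mxE deriveE// mulrC.
Qed.

Lemma is_derive_line (R : realType) (n : nat) (f : 'rV[R]_n -> R)
    (x v : 'rV[R]_n) (t : R) :
  differentiable f (x + t *: v) ->
  is_derive t 1 (fun s => f (x + s *: v)) (dot (grad f (x + t *: v)) v).
Proof.
move=> df.
have dl : is_diff t (fun s : R => x + s *: v) (cst 0 + *:%R ^~ v).
  exact: is_diffD.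
have dx : differentiable (fun s : R => x + s *: v) t by exact: ex_diff.
have dc := differentiable_comp dx df.
split; first by apply: diff_derivable; exact: dc.
rewrite deriveE; last exact: dc.
rewrite (congr1 (@^~ 1) (diff_comp dx df)) /=.
by rewrite diff_val/= fctE /= add0r scale1r diff_grad.
Qed.

(** By convexity the difference quotients from [x] towards [w] are at most [f w - f x] for steps [t]
    in (0, 1]; the bound passes to their limit at 0 from the right. *)
Lemma convex_grad_le (R : realType) (n : nat) (f : 'rV[R]_n -> R)
    (x w : 'rV[R]_n) :
  convex_function [set: 'rV[R]_n] f -> differentiable f x ->
  dot (grad f x) (w - x) <= f w - f x.
Proof.
move=> cf df; rewrite -diff_grad// -deriveE//.
have dfr : (fun h : R => h^-1 * (f (h *: (w - x) + x) - f x)) @ 0^'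
    --> 'D_(w - x) f x.
  exact: (@diff_derivable _ _ _ f x (w - x) df).
move/cvg_dnbhs_at_right/cvgr_to_le: dfr; apply.
near=> t.
have t0 : 0 < t by near: t; exact: nbhs_right_gt.
have t1 : t <= 1 by near: t; apply: nbhs_right_le.
rewrite mulrC ler_pdivrMr// lerBlDr.
have fc : f (t *: w + (1 - t) *: x) <= t * f w + (1 - t) * f x.
  exact: (cf (Itv01 (ltW t0) t1) w x (in_setT _) (in_setT _)).
have -> : t *: (w - x) + x = t *: w + (1 - t) *: x.
  by rewrite scalerBr scalerBl scale1r -addrA [- _ + x]addrC.
lra.
Unshelve. all: end_near.
Qed.

Lemma L_smooth_descent (R : realType) (n : nat) (L eta : R) (f : 'rV[R]_n -> R)
    (x : 'rV[R]_n) :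
  0 < L -> 0 < eta -> L_smooth L f ->
  f (x - eta *: grad f x)
  <= f x - eta * (1 - L * eta / 2) * enorm (grad f x) ^+ 2.
Proof.
move=> L0 eta0 Lf; set g := grad f x.
(* [phi] is [f] along the step minus its quadratic upper model; its derivative
   is nonpositive, so a mean value argument replaces the usual integral. *)
pose phi : R -> R := (fun t => f (x + t *: (- g))) +
  (dot g g \*: id - (L / 2 * dot g g) \*: (id ^+ 2)).
have phiE t : phi t = f (x + t *: (- g)) +
    (dot g g * t - L / 2 * dot g g * t ^+ 2) by [].
have dphi (t : R) : is_derive t 1 phi
    (dot (grad f (x + t *: (- g))) (- g) + dot g g - L * dot g g * t).
  have dfx := is_derive_line (L_smooth_differentiable Lf (x + t *: (- g))).
  have d1 : is_derive t 1 (dot g g \*: (id : R -> R)) (dot g g *: 1).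
    exact: is_deriveZ.
  have d2 : is_derive t 1 ((L / 2 * dot g g) \*: ((id : R -> R) ^+ 2))
      ((L / 2 * dot g g) *: ((2%:R * t ^+ 1) *: 1)).
    by apply: is_deriveZ; apply: is_deriveX.
  apply: (is_derive_eq (is_deriveD dfx (is_deriveB d1 d2))).
  by rewrite /GRing.scale /= expr1; field.
have [|c /[!in_itv]/= /andP[c0 _]] := @MVT R phi _ 0 eta eta0 (fun t _ => dphi t).
  apply/continuous_subspaceT => t.
  by apply/differentiable_continuous/derivable1_diffP; have [] := dphi t.
rewrite !phiE scale0r addr0 !mulr0 expr0n mulr0 !subr0 scalerN addr0 => E.
have := L_smooth_grad_lipschitz Lf (x + c *: (- g)) x.
set d := grad f _ - _; rewrite addrAC subrr add0r => dle.
have {dle} : enorm d ^+ 2 <= (L * enorm (c *: - g)) ^+ 2.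
  by rewrite ler_sqr ?nnegrE ?mulr_ge0 ?sqrtr_ge0 ?(ltW L0).
have gE : grad f (x + c *: - g) = d + g by rewrite subrK.
clearbody d; rewrite gE in E.
rewrite exprMn !enorm_sqr !dotE => dle.
(* Expanding [0 <= |d + (L c) g|^2] replaces Cauchy-Schwarz. *)
have := dot_ge0 (d + (L * c) *: g); rewrite !dotE (dotC g d) => d_ge0.
have Lc0 : 0 < L * c by rewrite mulr_gt0.
(* This is minus the derivative of [phi] at the mean value point [c], whence [phi eta <= phi 0]. *)
have dg : 0 <= dot d g + L * c * dot g g.
  rewrite -(pmulr_rge0 _ Lc0); nra.
rewrite !dotE in E; nra.
Qed.

(** * Limits forced by bounded partial sums *)

Lemma limn_einf_eq0 (R : realType) (u : nat -> R) :
  (\forall k \near \oo, 0 <= u k) ->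
  (forall (e : R) (n : nat), 0 < e -> exists2 k, (n <= k)%N & u k <= e) ->
  limn_einf (fun k => (u k)%:E) = 0%E.
Proof.
move=> [K _ u_ge0] u_small; rewrite limn_einf_lim; apply/eqP; rewrite eq_le.
apply/andP; split.
  apply: lime_le; first exact: is_cvg_einfs.
  apply: nearW => n; apply/lee_addgt0Pr => e e0; rewrite add0e.
  have [k nk uk] := u_small e n e0.
  apply: (@le_trans _ _ (u k)%:E); last by rewrite lee_fin.
  by apply: ereal_inf_lbound; exists k.
apply: lime_ge; first exact: is_cvg_einfs.
exists K => //= n /= Kn; apply: le_ereal_inf_tmp => _ [k /= nk <-].
by rewrite lee_fin u_ge0//=; exact: leq_trans nk.
Qed.

Lemma ln_sub_le (R : realType) (a b : R) :
  0 < a -> a <= b -> ln b - ln a <= (b - a) / a.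
Proof.
move=> a0 ab; have b0 : 0 < b by exact: lt_le_trans ab.
rewrite -ln_div ?posrE//.
have -> : b / a = 1 + (b - a) / a by field; rewrite gt_eqF.
apply: le_ln1Dx; apply: (lt_le_trans (ltrN10 R)).
by rewrite divr_ge0 ?subr_ge0// ltW.
Qed.

Lemma lt_ln_expR (R : realType) (a b : R) : expR a < b -> a < ln b.
Proof.
move=> ab; rewrite -[ltLHS]expRK ltr_ln ?posrE ?expR_gt0//.
by rewrite (lt_trans (expR_gt0 a)).
Qed.

(** [ln (1 + t) <= t] is applied once per logarithm, outermost first, and each use yields one factor
    of the denominator. The lower bound on [k] makes [ln (ln k)] positive. *)
Lemma ln3_sub_le (R : realType) (k : nat) : expR 1 < k%:R :> R ->
  ln (ln (ln k.+1%:R)) - ln (ln (ln k%:R))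
  <= (k%:R * ln k%:R * ln (ln k%:R))^-1 :> R.
Proof.
move=> ek.
have k0 : 0 < k%:R :> R by apply: lt_trans ek; exact: expR_gt0.
have lk : 1 < ln k%:R :> R by exact: lt_ln_expR.
have lk0 : 0 < ln k%:R :> R by exact: lt_trans lk.
have llk0 : 0 < ln (ln k%:R) :> R by rewrite ln_gt0.
have le1 : k%:R <= k.+1%:R :> R by rewrite ler_nat.
have le2 : ln k%:R <= ln k.+1%:R :> R by rewrite ler_ln ?posrE.
have le3 : ln (ln k%:R) <= ln (ln k.+1%:R) :> R.
  by rewrite ler_ln ?posrE// (lt_le_trans lk0).
apply: (le_trans (ln_sub_le llk0 le3)).
rewrite !invfM ler_pdivrMr// divfK ?gt_eqF//.
apply: (le_trans (ln_sub_le lk0 le2)).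
rewrite ler_pM2r ?invr_gt0//; apply: (le_trans (ln_sub_le k0 le1)).
by rewrite -natr1 addrAC subrr add0r mul1r.
Qed.

(** If the weighted terms eventually stayed above some [e > 0], [a k] would dominate [e] times the
    increments of the triple logarithm and its partial sums would be unbounded. *)
Lemma limn_einf_mul_ln_lnln (R : realType) (a : nat -> R) (S : R) :
  (forall k, 0 <= a k) -> (forall N, \sum_(k < N) a k <= S) ->
  limn_einf (fun k : nat => (k%:R * ln k%:R * ln (ln k%:R) * a k)%:E) = 0%E.
Proof.
move=> a0 aS.
have big (M : R) : exists K : nat, forall k, (K <= k)%N -> M < k%:R.
  exists (Num.bound `|M|) => k Kk; apply: (le_lt_trans (ler_norm M)).
  by rewrite (lt_le_trans (archi_boundP _))// ler_nat.
have [K0 K0P] := big (expR 1).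
have w0 k : (K0 <= k)%N -> 0 < k%:R * ln k%:R * ln (ln k%:R) :> R.
  move=> /K0P ek.
  have k0 : 0 < k%:R :> R by apply: lt_trans ek; exact: expR_gt0.
  have lk : 1 < ln k%:R :> R by exact: lt_ln_expR.
  by rewrite mulr_gt0 ?mulr_gt0 ?(lt_trans ltr01 lk)// ln_gt0.
apply: limn_einf_eq0.
  (* Positivity of the weight is only eventual: [ln (ln k)] is negative at [k = 2]. *)
  by exists K0 => // k /= Kk; rewrite mulr_ge0// ltW// w0.
move=> e n e0; apply: contrapT => Hn.
have {}Hn k : (n <= k)%N -> e < k%:R * ln k%:R * ln (ln k%:R) * a k.
  by move=> nk; rewrite ltNge; apply/negP => ?; apply: Hn; exists k.
pose K := maxn n K0; pose w k : R := ln (ln (ln k%:R)).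
have step k : (K <= k)%N -> e * (w k.+1 - w k) <= a k.
  rewrite geq_max => /andP[nk Kk].
  apply: (@le_trans _ _ (e * (k%:R * ln k%:R * ln (ln k%:R))^-1)).
    by rewrite ler_pM2l// ln3_sub_le// K0P.
  by rewrite ler_pdivrMr ?w0// mulrC ltW// Hn.
have sumw m : e * (w (K + m)%N - w K) <= \sum_(k < K + m) a k.
  elim: m => [|m IH].
    by rewrite addn0 subrr mulr0 sumr_ge0.
  rewrite addnS big_ord_recr /=.
  have := step _ (leq_addr m K); lra.
(* The triple exponential makes [w (K + K1)] exceed [w K + S / e], so that a partial sum exceeds
   [S]. *)
have [K1 K1P] := big (expR (expR (expR (w K + S / e)))).
have /lt_ln_expR/lt_ln_expR/lt_ln_expR := K1P (K + K1)%N (leq_addl _ _).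
rewrite -/(w (K + K1)%N) -ltrBrDl ltr_pdivrMr// mulrC => S_lt.
by have := lt_le_trans S_lt (le_trans (sumw K1) (aS _)); rewrite ltxx.
Qed.

(** With [m = k./2], the block from [m] to [k] has at least [m] terms, each at least [m * d k]; so
    [m ^+ 2 * d k] is at most a block sum that tends to 0. *)
Lemma antitone_sum_bounded_cvg0 (R : realType) (d : nat -> R) (S : R) :
  (forall k, 0 <= d k) -> (forall k, d k.+1 <= d k) ->
  (forall N, \sum_(k < N) k%:R * d k <= S) ->
  (fun k => k%:R ^+ 2 * d k) @ \oo --> (0 : R).
Proof.
move=> d0 dS sS.
have dle j k : (j <= k)%N -> d k <= d j.
  by move=> /subnK <-; elim: (k - j)%N => // m /(le_trans (dS _)).
pose s N : R := \sum_(0 <= k < N) k%:R * d k.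
have cs : cvgn s.
  apply: nondecreasing_is_cvgn.
    apply/nondecreasing_seqP => k; rewrite /s big_nat_recr//= lerDl.
    by rewrite mulr_ge0.
  by exists S => _ [N _ <-]; rewrite /s big_mkord.
(* The factor 9 is the square of 3 in [k <= 3 * k./2], valid for [k >= 2] and sharp at [k = 3]. *)
have tail : (fun k => 9 * (s k - s k./2)) @ \oo --> (0 : R).
  suff : (fun k => 9 * (s k - s k./2)) @ \oo --> 9 * (limn s - limn s).
    by rewrite subrr mulr0.
  apply: cvgMr; apply: cvgB => //.
  apply: cvg_comp cs => A [N _ NA]; exists N.*2 => // k /= Nk.
  by apply: NA => /=; rewrite -(doubleK N) half_leq.
apply: (squeeze_cvgr _ (cvg_cst 0) tail).
near=> k; rewrite mulr_ge0//=.
have k2 : (2 <= k)%N by near: k; exists 2%N.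
set m := k./2; have mk : (m <= k)%N by lia.
have -> : s k - s m = \sum_(m <= j < k) j%:R * d j.
  by rewrite /s (@big_cat_nat _ _ _ m 0 k)//= addrAC subrr add0r.
have : \sum_(m <= j < k) (m%:R * d k) <= \sum_(m <= j < k) j%:R * d j.
  rewrite big_nat [leRHS]big_nat; apply: ler_sum => j /andP[mj jk].
  by rewrite ler_pM// ?ler_nat// dle// ltnW.
rewrite sumr_const_nat.
have le3m : k%:R <= 3 * m%:R :> R by rewrite -natrM ler_nat; lia.
have lem : m%:R + m%:R <= k%:R :> R by rewrite -natrD ler_nat; lia.
rewrite -[_ *+ (k - m)]mulr_natl natrB// => sum_ge.
have : m%:R * (m%:R * d k) <= (k%:R - m%:R) * (m%:R * d k).
  by rewrite ler_wpM2r ?mulr_ge0//; lra.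
have : k%:R ^+ 2 * d k <= (3 * m%:R) ^+ 2 * d k.
  by rewrite ler_wpM2r// ler_sqr ?nnegrE.
lra.
Unshelve. all: end_near.
Qed.

(** * Descent along the iterates and the nonconvex bound *)

Section NSA.
Context (R : realType) (n : nat) (L eta p : R) (f : 'rV[R]_n -> R).
Context (x y z : nat -> 'rV[R]_n).
Context (L0 : 0 < L) (p3 : 3 <= p).
Context (eta0 : 0 < eta) (etaL : eta <= 2 / (3 * L)).
Context (run : NSA_run f eta p x y z) (Lf : L_smooth L f).

(** Since [L * eta <= 2 / 3], the factor [1 - L * eta / 2] is at least [2 / 3]. *)
Lemma short_step_descent (v : 'rV[R]_n) :
  f (v - eta *: grad f v) <= f v - 2 / 3 * eta * enorm (grad f v) ^+ 2.
Proof.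
apply: (le_trans (L_smooth_descent _ L0 eta0 Lf)).
rewrite lerD2l lerN2 ler_wpM2r ?sqr_ge0// mulrC ler_pM2l//.
have : L * eta <= 2 / 3.
  apply: (@le_trans _ _ (L * (2 / (3 * L)))); first by rewrite ler_pM2l.
  by rewrite le_eqVlt; apply/orP; left; apply/eqP; field; rewrite gt_eqF.
lra.
Qed.

Lemma NSA_descent_x (k : nat) :
  f (x k.+1) <= f (x k) - 2 / 3 * eta * enorm (grad f (x k)) ^+ 2.
Proof.
rewrite (NSA_x run) /=; case: ifPn => [fle|_]; last exact: short_step_descent.
exact: le_trans fle (short_step_descent _).
Qed.

(** The selected candidate is never worse than the gradient step from [y k]. This is the descent
    used by the Lyapunov argument. *)
Lemma NSA_descent_y (k : nat) :
  f (x k.+1) <= f (y k) - 2 / 3 * eta * enorm (grad f (y k)) ^+ 2.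
Proof.
rewrite (NSA_x run) /=; case: ifPn => [_|]; first exact: short_step_descent.
by rewrite -ltNge => /ltW/le_trans; apply; exact: short_step_descent.
Qed.

Lemma NSA_min_grad_le (N : nat) : has_lbound (range f) ->
  \big[Num.min/enorm (grad f (x 0%N)) ^+ 2]_(k < N.+1)
     enorm (grad f (x k)) ^+ 2
  <= 3 * (f (x 0%N) - inf (range f)) / (2 * eta * (N%:R + 1)).
Proof.
move=> fb; set m := \big[_/_]_(_ < _) _.
have mle (k : 'I_N.+1) : m <= enorm (grad f (x k)) ^+ 2 by exact: bigmin_le.
have N0 : 0 < N%:R + 1 :> R by rewrite natr1.
rewrite ler_pdivlMr ?mulr_gt0//.
(* The restriction on [j] keeps every gradient used within the range of the minimum [m]. *)
have sum_le : forall j, (j <= N.+1)%N ->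
    f (x j) + j%:R * (2 / 3 * eta * m) <= f (x 0%N).
  elim=> [|j IH] jN; first by rewrite mul0r addr0.
  have := NSA_descent_x j; have := IH (ltnW jN); rewrite -natr1.
  have : 2 / 3 * eta * m <= 2 / 3 * eta * enorm (grad f (x j)) ^+ 2.
    have c0 : 0 < 2 / 3 * eta by rewrite mulr_gt0.
    by rewrite (ler_pM2l c0); exact: (mle (Ordinal jN)).
  lra.
have := sum_le _ (leqnn _).
have : inf (range f) <= f (x N.+1) by apply: ge_inf => //; exists (x N.+1).
rewrite -natr1; lra.
Qed.

(** * Convex case: Lyapunov decrease and rates *)

Section convex.
Context (fstar : R) (xs : 'rV[R]_n).
Context (cf : convex_function [set: 'rV[R]_n] f).
Context (fxs : f xs = fstar) (fmin : forall v, fstar <= f v).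

(* The usual Nesterov Lyapunov function, multiplied by [p ^+ 2]. *)
Definition lyapunov (k : nat) : R :=
  p ^+ 2 * dot (z k - xs) (z k - xs)
  + 2 * eta * (k%:R + p - 1) ^+ 2 * (f (x k) - fstar).

Lemma lyapunov_ge0 (k : nat) : 0 <= lyapunov k.
Proof.
apply: addr_ge0; apply: mulr_ge0; rewrite ?dot_ge0 ?sqr_ge0 ?subr_ge0//.
by rewrite mulr_ge0 ?sqr_ge0// mulr_ge0// ltW.
Qed.

(* The increment of the weight of [f (x k) - fstar] falls short by a term of
   order [k], and the descent constant [2/3 > 1/2] leaves a positive multiple of
   [|grad f (y k)|^2]: these two leftovers are what becomes summable. *)
Lemma lyapunov_decrease (k : nat) :
  lyapunov k.+1 + (2 * eta * (k%:R * (f (x k) - fstar))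
    + eta ^+ 2 / 3 * (k%:R ^+ 2 * enorm (grad f (y k)) ^+ 2)) <= lyapunov k.
Proof.
have p0 : 0 < p by apply: lt_le_trans p3.
have k0 : 0 <= k%:R :> R by [].
(* [q] is the inverse of [NSA_alpha p k]; replacing [k] by [p * q - p] makes the final inequality
   polynomial. *)
pose q := (k%:R + p) / p.
have q0 : 0 < q by rewrite divr_gt0// ltr_wpDl.
have q1 : 0 <= q - 1 by rewrite subr_ge0 ler_pdivlMr// mul1r lerDr.
have qE : p * q = k%:R + p by rewrite /q mulrC divfK ?gt_eqF.
have aE : NSA_alpha p k = q^-1 by rewrite /q invf_div.
have := NSA_descent_y k; rewrite enorm_sqr; set g := grad f (y k) => xy.
have gxs := convex_grad_le xs cf (L_smooth_differentiable Lf (y k)).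
have gx := convex_grad_le (x k) cf (L_smooth_differentiable Lf (y k)).
have zE : z k = x k + q *: (y k - x k).
  apply/rowP => i; rewrite (NSA_y run) aE !mxE; field.
  by rewrite gt_eqF.
have zz : z k.+1 - xs = (z k - xs) - (eta * q) *: g.
  by rewrite (NSA_z run) aE invrK addrAC.
(* Since [z k - xs = (y k - xs) + (q - 1) *: (y k - x k)], the gradient inequalities towards [xs]
   and [x k] are added with weights 1 and [q - 1]. *)
have gz : q * (f (y k) - fstar) - (q - 1) * (f (x k) - fstar) <= dot g (z k - xs).
  have -> : z k - xs = - (xs - y k) - (q - 1) *: (x k - y k).
    by rewrite zE; apply/rowP => i; rewrite !mxE; ring.
  rewrite dotDr !dotNr dotZr.
  have := mulr_ge0 q1 (_ : 0 <= f (x k) - f (y k) - dot g (x k - y k)).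
  rewrite subr_ge0 => /(_ gx); rewrite -/g fxs in gxs.
  lra.
have fx0 : 0 <= f (x k) - fstar by rewrite subr_ge0.
have gg0 := dot_ge0 g.
rewrite /lyapunov zz -[k.+1%:R]natr1; move: (z k - xs) gz => A gz.
have -> : k%:R = p * q - p :> R by rewrite qE addrK.
rewrite dotDl !dotDr !dotNl !dotNr !dotZl !dotZr (dotC A g).
have [eta_ge0 q_ge0 p_ge0] : [/\ 0 <= eta, 0 <= q & 0 <= p] by split; exact: ltW.
(* The multiplier of [gz] matches the cross term of [p ^+ 2 * |z k.+1 - xs|^2], that of [xy] the
   weight of [f (x k.+1)]; the [f (y k)] terms then cancel. *)
have c1 : 0 <= p ^+ 2 * (2 * eta * q).
  by rewrite mulr_ge0 ?sqr_ge0// mulr_ge0// mulr_ge0.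
have c2 : 0 <= p ^+ 2 * (2 * eta * q ^+ 2).
  by rewrite mulr_ge0 ?sqr_ge0// mulr_ge0 ?sqr_ge0// mulr_ge0.
have := ler_wpM2l c1 gz; have := ler_wpM2l c2 xy.
(* Here [2 * q - 1] is [q ^+ 2 - (q - 1) ^+ 2], the price of writing the gradient term with [k]
   instead of [k + p]. *)
have : 0 <= eta ^+ 2 * p ^+ 2 * (2 * q - 1) * dot g g.
  rewrite mulr_ge0// mulr_ge0//; first by rewrite mulr_ge0 ?sqr_ge0.
  lra.
(* The leftover coefficient of [f (x k) - fstar] is [2 * eta * (p * q * (p - 3) + (p + 1))]; this is
   where [p >= 3] enters. *)
have : 0 <= eta * (p * q) * (p - 3) * (f (x k) - fstar).
  by rewrite mulr_ge0// mulr_ge0 ?subr_ge0// mulr_ge0// mulr_ge0.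
have : 0 <= eta * (p + 1) * (f (x k) - fstar).
  by rewrite mulr_ge0// mulr_ge0// addr_ge0.
move=> h1 h2 h3 h4 h5; lra.
Qed.

Lemma lyapunov_sum (N : nat) :
  \sum_(k < N) (2 * eta * (k%:R * (f (x k) - fstar))
    + eta ^+ 2 / 3 * (k%:R ^+ 2 * enorm (grad f (y k)) ^+ 2)) <= lyapunov 0.
Proof.
suff : \sum_(k < N) (2 * eta * (k%:R * (f (x k) - fstar))
    + eta ^+ 2 / 3 * (k%:R ^+ 2 * enorm (grad f (y k)) ^+ 2)) + lyapunov N
    <= lyapunov 0.
  by have := lyapunov_ge0 N; lra.
elim: N => [|N IH]; first by rewrite big_ord0 add0r.
rewrite big_ord_recr /=; have := lyapunov_decrease N; lra.
Qed.

Lemma NSA_cvx_rates :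
  [/\ limn_esup (fun k : nat => (k%:R ^+ 2 * (f (x k) - fstar))%:E) = 0%E,
      limn_einf (fun k : nat =>
        (k%:R ^+ 2 * ln k%:R * ln (ln k%:R) * (f (x k) - fstar))%:E) = 0%E
    & limn_einf (fun k : nat =>
        (k%:R ^+ 3 * ln k%:R * ln (ln k%:R) * enorm (grad f (y k)) ^+ 2)%:E)
      = 0%E].
Proof.
have d_ge0 k : 0 <= f (x k) - fstar by rewrite subr_ge0.
have kd_ge0 k : 0 <= k%:R * (f (x k) - fstar) by rewrite mulr_ge0.
have kg_ge0 k : 0 <= k%:R ^+ 2 * enorm (grad f (y k)) ^+ 2.
  by rewrite mulr_ge0 ?sqr_ge0.
have c1 : 0 < 2 * eta by rewrite mulr_gt0.
have c2 : 0 < eta ^+ 2 / 3 by rewrite divr_gt0 ?exprn_gt0.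
have sum_d N : \sum_(k < N) k%:R * (f (x k) - fstar) <= lyapunov 0 / (2 * eta).
  rewrite ler_pdivlMr// mulrC (le_trans _ (lyapunov_sum N))// mulr_sumr.
  by apply: ler_sum => k _; rewrite lerDl mulr_ge0// ltW.
have sum_g N : \sum_(k < N) k%:R ^+ 2 * enorm (grad f (y k)) ^+ 2
    <= lyapunov 0 / (eta ^+ 2 / 3).
  rewrite ler_pdivlMr// mulrC (le_trans _ (lyapunov_sum N))// mulr_sumr.
  by apply: ler_sum => k _; rewrite lerDr mulr_ge0// ltW.
split.
- apply: (cvg_limn_einf_sup _).2; apply: cvg_EFin; first exact: nearW.
  apply: antitone_sum_bounded_cvg0 sum_d => // k.
  rewrite lerD2r (le_trans (NSA_descent_x k))// gerBl.
  by rewrite mulr_ge0 ?sqr_ge0// mulr_ge0// ltW.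
(* One power of [k] stays in the logarithmic weight; the remaining ones belong to the summable
   sequence. *)
- rewrite -(limn_einf_mul_ln_lnln kd_ge0 sum_d); congr limn_einf.
  by apply/funext => k; congr EFin; ring.
- rewrite -(limn_einf_mul_ln_lnln kg_ge0 sum_g); congr limn_einf.
  by apply/funext => k; congr EFin; ring.
Qed.
End convex.
End NSA.

Theorem theorem1 (R : realType) (n : nat) (hn : (1 <= n)%N)
    (L : R) (hL : 0 < L) (p : R) (hp : 3 <= p)
    (eta : R) (heta0 : 0 < eta) (heta : eta <= 2 / (3 * L))
    (f : 'rV[R]_n -> R) (x y z : nat -> 'rV[R]_n)
    (hrun : NSA_run f eta p x y z) :
  (convex_function [set: 'rV[R]_n] f -> L_smooth L f ->
   forall fstar : R, is_minimum f fstar ->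
     [/\ limn_esup (fun k : nat => (k%:R ^+ 2 * (f (x k) - fstar))%:E) = 0%E,
         limn_einf (fun k : nat =>
           (k%:R ^+ 2 * ln k%:R * ln (ln k%:R) * (f (x k) - fstar))%:E) = 0%E
       & limn_einf (fun k : nat =>
           (k%:R ^+ 3 * ln k%:R * ln (ln k%:R) * enorm (grad f (y k)) ^+ 2)%:E)
         = 0%E])
  /\
  (L_smooth L f -> has_lbound (range f) ->
   forall N : nat,
     \big[Num.min/enorm (grad f (x 0%N)) ^+ 2]_(k < N.+1)
        enorm (grad f (x k)) ^+ 2
     <= 3 * (f (x 0%N) - inf (range f)) / (2 * eta * (N%:R + 1))).
Proof.
split=> [cf Lf fstar [[xs _ fxs] flb]|Lf fb N].
  apply: (NSA_cvx_rates hL hp heta0 heta hrun Lf cf fxs) => v.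
  by apply: flb; exists v.
exact: (NSA_min_grad_le hL heta0 heta hrun Lf).
Qed.
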